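(* Let $r,t$ be positive integers with $r\neq t$. Then the complete bipartite graph $K_{r,t}$ is of class $1^\pm$.
   Context: A signed graph is a pair $(G,\sigma)$ with $G$ a finite simple graph and $\sigma\colon E(G)\to\{\pm1\}$ a signature. An incidence is a pair $v\colon e$ with $v$ an endpoint of edge $e$; $I(G)$ is the set of incidences. For a positive integer $n$ let $M_n=\{0,\pm1,\dots,\pm k\}$ if $n=2k+1$ and $M_n=\{\pm1,\dots,\pm k\}$ if $n=2k$. An $n$-edge-coloring of $(G,\sigma)$ is a map $f\colon I(G)\to M_n$ with $f(u\colon uv)=-\sigma(uv)f(v\colon uv)$ for every edge $uv$, and $f(u\colon e_1)\neq f(u\colon e_2)$ whenever $e_1\neq e_2$ are both incident to $u$. The chromatic index $\chi'(G,\sigma)$ is the least positive integer $n$ for which an $n$-edge-coloring exists. A graph $G$ is of class $1^\pm$ if $\chi'(G,\sigma)=\Delta(G)$ for every signature $\sigma$ of $G$, where $\Delta(G)$ is the maximum degree. *)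

(* Defs.v *)
From mathcomp Require Import all_boot all_order all_algebra.
Set Implicit Arguments.
Unset Strict Implicit.
Unset Printing Implicit Defensive.
Import Order.TTheory GRing.Theory Num.Theory.
Local Open Scope ring_scope.

Record sgraph := SGraph {
  vertex :> finType;
  adj : rel vertex;
  adj_sym : symmetric adj;
  adj_irrefl : irreflexive adj
}.

Definition edges (G : sgraph) : {set {set G}} :=
  [set [set p.1; p.2] | p : G * G & adj p.1 p.2].

Definition edge (G : sgraph) := {e : {set G} | e \in edges G}.

Definition incidence (G : sgraph) :=
  {i : G * edge G | i.1 \in val i.2}.

Definition ivertex (G : sgraph) (i : incidence G) : G := (val i).1.
Definition iedge (G : sgraph) (i : incidence G) : edge G := (val i).2.

Definition max_degree (G : sgraph) : nat :=
  \max_(x : G) #|[set y | adj x y]|.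

Definition is_signature (G : sgraph) (sigma : edge G -> int) : Prop :=
  forall e, sigma e = 1 \/ sigma e = -1.

(* For n = 2k or n = 2k+1 one has n./2 = k; 0 is a color only for odd n. *)
Definition colors (n : nat) : pred int :=
  fun c => (`|c| <= n./2%:Z) && (odd n || (c != 0)).

Definition is_edge_coloring (G : sgraph) (sigma : edge G -> int) (n : nat)
    (f : incidence G -> int) : Prop :=
  [/\ forall i, f i \in colors n,
      forall i j, iedge i = iedge j -> ivertex i <> ivertex j ->
        f i = - sigma (iedge i) * f j
    & forall i j, ivertex i = ivertex j -> iedge i <> iedge j ->
        f i <> f j].

Definition edge_colorable (G : sgraph) (sigma : edge G -> int) (n : nat) :
    Prop :=
  exists f : incidence G -> int, is_edge_coloring sigma n f.

Definition is_chromatic_index (G : sgraph) (sigma : edge G -> int) (n : nat) :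
    Prop :=
  [/\ (0 < n)%N, edge_colorable sigma n
    & forall m : nat, (0 < m)%N -> edge_colorable sigma m -> (n <= m)%N].

Definition class1pm (G : sgraph) : Prop :=
  forall sigma : edge G -> int,
    is_signature sigma -> is_chromatic_index sigma (max_degree G).

Section CompleteBipartite.
Variables r t : nat.

Definition Kadj : rel ('I_r + 'I_t)%type := fun x y =>
  match x, y with
  | inl _, inr _ | inr _, inl _ => true
  | _, _ => false
  end.

Lemma Kadj_sym : symmetric Kadj.
Proof. by move=> [x|x] [y|y]. Qed.

Lemma Kadj_irrefl : irreflexive Kadj.
Proof. by move=> [x|x]. Qed.

Definition complete_bipartite : sgraph := SGraph Kadj_sym Kadj_irrefl.

End CompleteBipartite.

(* Main.v *)
Require Import Defs.
From mathcomp Require Import all_boot.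
From mathcomp Require Import all_order all_algebra zify.

(**
Take the side of size [r < t] to be a_0, ..., a_{r-1} and the other side to be
b_0, ..., b_{t-1}, with indices modulo t.  For 0 <= s < t/2 the edges
a_i b_{i+2s} and a_i b_{i+2s+1} form a single path
b_{2s}, a_0, b_{2s+1}, a_1, ..., a_{r-1}, b_{2s+r}, which does not close up
because r < t.  A path can be colored by the two colors s+1 and -(s+1) whatever
the signature, since only unbalanced cycles obstruct this.  If t is odd the
remaining edges a_i b_{i+t-1} form a matching, which receives the color 0.
*)

Set Implicit Arguments.
Unset Strict Implicit.
Unset Printing Implicit Defensive.
Import Order.TTheory GRing.Theory Num.Theory.
Local Open Scope ring_scope.

(** * Size of the palette *)

Lemma size_uniq_colors (n : nat) (s : seq int) :
  uniq s -> {subset s <= colors n} -> (size s <= n)%N.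
Proof.
move=> us sc.
(* Shifting by n./2 maps the colors to 0 .. n - 1; for even n the missing
   color 0 is skipped. *)
pose h (c : int) : nat :=
  if odd n || (c < 0) then absz (c + n./2%:Z)%R else absz (c + n./2%:Z - 1)%R.
have hinj : {in s &, injective h}.
  move=> x y /sc + /sc; rewrite !unfold_in /h.
  by case: (odd n) => /=; case: (ltP x 0); case: (ltP y 0); lia.
rewrite -(size_map h) -[leqRHS](size_iota 0); apply: uniq_leq_size.
  by rewrite map_inj_in_uniq.
move=> _ /mapP [x /sc + ->]; rewrite mem_iota !unfold_in /h.
have := odd_double_half n.
by case: (odd n) => /=; case: (ltP x 0); lia.
Qed.

(** * Coloring along paths, on natural-number indices *)

Section PathColoring.
Variables (r t : nat) (s : nat -> nat -> int).
Hypothesis lt_rt : (r < t)%N.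
Hypothesis s_sign : forall i j, s i j = 1 \/ s i j = -1.

(** For indices below t this is j - i modulo t. Its half numbers the path through the edge; its
    parity tells the first edge at a_i from the second. *)
Let offset (i j : nat) : nat := if (i <= j)%N then (j - i)%N else (j + t - i)%N.
Let wrap (x : nat) : nat := if (x < t)%N then x else (x - t)%N.

(* [path_sign k i] is the sign at a_i of its first edge on the k-th path; the
   recursion makes the two colors at b_{i+1+2k} opposite. *)
Fixpoint path_sign (k i : nat) : int :=
  if i is i'.+1 then
    path_sign k i' * s i' (wrap (i + k.*2)) * s i (wrap (i + k.*2))
  else 1.

(** The color at the a_i end. For d < t the test [d./2 == t./2] succeeds only when t is odd and d =
    t - 1, the leftover matching; the successor keeps path colors nonzero. *)
Let lcolor (i j : nat) : int :=
  let d := offset i j in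
  if d./2 == t./2 then 0
  else (if odd d then -1 else 1) * path_sign d./2 i * (d./2).+1%:Z.

Lemma path_sign_pm k i : path_sign k i = 1 \/ path_sign k i = -1.
Proof.
elim: i => [|i IH] /=; first by left.
set x := wrap _.
by case: IH => ->; case: (s_sign i x) => ->; case: (s_sign i.+1 x) => ->;
  rewrite ?mulrNN ?mulr1 ?mul1r; auto.
Qed.

(** Colors at the b ends are forced by the signature. At a_i parity already makes the two edges of a
    path opposite, so [path_sign] only has to settle the b ends. *)
Lemma path_bicoloring :
  exists ca cb : nat -> nat -> int,
  [/\ forall i j, (i < r)%N -> (j < t)%N ->
        (ca i j \in colors t) && (cb i j \in colors t),
      forall i j, ca i j = - s i j * cb i j,
      forall i j j', (i < r)%N -> (j < t)%N -> (j' < t)%N ->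
        ca i j = ca i j' -> j = j'
    & forall i i' j, (i < r)%N -> (i' < r)%N -> (j < t)%N ->
        cb i j = cb i' j -> i = i'].
Proof.
exists lcolor, (fun i j => - s i j * lcolor i j); split.
- move=> i j lt_ir lt_jt.
  have colN (u : int) : u = 1 \/ u = -1 ->
      lcolor i j \in colors t -> u * lcolor i j \in colors t.
    by case=> ->; rewrite ?mul1r ?mulN1r // !unfold_in normrN oppr_eq0.
  have cl : lcolor i j \in colors t.
    rewrite !unfold_in /lcolor; have : (offset i j < t)%N.
      by rewrite /offset; case: ifP; lia.
    move: (offset i j) => d lt_dt.
    case: eqP => [e|ne]; first by have : odd t; lia.
    case: (path_sign_pm d./2 i) => ->; case: (odd d); lia.
  by rewrite cl colN //; case: (s_sign i j) => ->; auto.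
- by move=> i j; case: (s_sign i j) => ->; lia.
- move=> i j j' lt_ir lt_jt lt_j't.
  suff : lcolor i j = lcolor i j' -> offset i j = offset i j'.
    by move=> h /h; rewrite /offset; case: ifP; case: ifP; lia.
  have : (offset i j < t)%N by rewrite /offset; case: ifP; lia.
  have : (offset i j' < t)%N by rewrite /offset; case: ifP; lia.
  rewrite /lcolor; move: (offset i j) (offset i j') => d d' lt_d't lt_dt.
  have [e|ne] := eqVneq d./2 t./2; have [e'|ne'] := eqVneq d'./2 t./2.
  + by lia.
  + by case: (path_sign_pm d'./2 i) => ->; case: (odd d'); lia.
  + by case: (path_sign_pm d./2 i) => ->; case: (odd d); lia.
  + have [ed|ned] := eqVneq d./2 d'./2; last first.
      by case: (path_sign_pm d./2 i) => ->; case: (path_sign_pm d'./2 i) => ->;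
        case: (odd d); case: (odd d'); lia.
    rewrite ed; have := odd_double_half d; have := odd_double_half d'; move: ed.
    by case: (path_sign_pm d'./2 i) => ->;
      case: (odd d); case: (odd d'); lia.
- move=> i i' j.
  (* By symmetry, if the two offsets differ in parity, the odd one belongs to a_i. *)
  wlog le_odd : i i' / (odd (offset i' j) <= odd (offset i j))%N.
    move=> H lt_ir lt_i'r lt_jt e.
    case: (leqP (odd (offset i' j)) (odd (offset i j))) => h.
      exact: H.
    by apply/esym/H => //; apply: ltnW.
  move=> lt_ir lt_i'r lt_jt.
  have same : offset i j = offset i' j -> i = i'.
    by rewrite /offset; case: ifP; case: ifP; lia.
  have : (offset i j < t)%N by rewrite /offset; case: ifP; lia.
  have : (offset i' j < t)%N by rewrite /offset; case: ifP; lia.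
  (* Here r < t enters: the offsets give i' = i + 1 only modulo t, and the excluded case i = t - 1,
     i' = 0 would close the path. *)
  have next k : offset i j = k.*2.+1 -> offset i' j = k.*2 ->
      i' = i.+1 /\ j = wrap (i.+1 + k.*2).
    by rewrite /offset /wrap; case: ifP; case: ifP; case: ifP; lia.
  rewrite /lcolor; move: (offset i j) (offset i' j) same next le_odd.
  move=> d d' same next le_odd lt_d't lt_dt.
  have [e|ne] := eqVneq d./2 t./2; have [e'|ne'] := eqVneq d'./2 t./2.
  + by move=> _; apply: same; lia.
  + by case: (path_sign_pm d'./2 i') => ->; case: (s_sign i' j) => ->;
      case: (odd d'); lia.
  + by case: (path_sign_pm d./2 i) => ->; case: (s_sign i j) => ->;
      case: (odd d); lia.
  + have [ed|ned] := eqVneq d./2 d'./2; last first.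
      by case: (path_sign_pm d./2 i) => ->; case: (path_sign_pm d'./2 i') => ->;
        case: (s_sign i j) => ->; case: (s_sign i' j) => ->;
        case: (odd d); case: (odd d'); lia.
    have [eo _|neo] := eqVneq (odd d) (odd d'); first by apply: same; lia.
    have [od od'] : odd d /\ ~~ odd d'.
      by move: neo le_odd; case: (odd d); case: (odd d').
    have [||ei' ej] := next d'./2; [lia..|].
    (* For consecutive edges of one path, unfolding [path_sign] once at a_{i+1} yields opposite
       nonzero colors at b_j. *)
    rewrite ed od (negPf od') ei' /= -ej.
    by case: (path_sign_pm d'./2 i) => ->; case: (s_sign i j) => ->;
      case: (s_sign i.+1 j) => ->; lia.
Qed.

End PathColoring.

Lemma ordinal_bicoloring (r t : nat) (s : 'I_r -> 'I_t -> int) :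
  (r < t)%N -> (forall i j, s i j = 1 \/ s i j = -1) ->
  exists ca cb : 'I_r -> 'I_t -> int,
  [/\ forall i j, (ca i j \in colors t) && (cb i j \in colors t),
      forall i j, ca i j = - s i j * cb i j,
      forall i, injective (ca i)
    & forall j, injective (cb^~ j)].
Proof.
move=> lt_rt s_sign.
(* The default 1 keeps [s'] a sign at all naturals, as [path_bicoloring] requires. *)
pose s' (i j : nat) : int :=
  if (insub i : option 'I_r, insub j : option 'I_t) is (Some a, Some b)
  then s a b else 1.
have s'_sign i j : s' i j = 1 \/ s' i j = -1.
  rewrite /s'; case: (insub i) => [a|]; last by left.
  by case: (insub j) => [b|]; auto.
have [ca [cb [h1 h2 h3 h4]]] := path_bicoloring lt_rt s'_sign.
exists (fun i j => ca i j), (fun i j => cb i j); split.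
- by move=> i j; apply: h1.
- by move=> i j; rewrite h2 /s' !valK.
- by move=> i j j' /h3 e; apply/val_inj/e.
- by move=> j i i' /h4 e; apply/val_inj/e.
Qed.

(** * Edges and incidences of the complete bipartite graph as index pairs *)

Section CompleteBipartiteColoring.
Variables r t : nat.
Local Notation K := (complete_bipartite r t).

Definition ends (i : 'I_r) (j : 'I_t) : {set K} := [set inl i; inr j].

Lemma ends_edge i j : ends i j \in edges K.
Proof. by apply/imsetP; exists (inl i, inr j); rewrite ?inE. Qed.

Definition kedge i j : edge K := exist _ (ends i j) (ends_edge i j).

Lemma inl_ends a i j : (inl a \in ends i j) = (a == i).
Proof. by rewrite !inE orbF. Qed.

Lemma inr_ends b i j : (inr b \in ends i j) = (b == j).
Proof. by rewrite !inE. Qed.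

Lemma ends_inj i j i' j' : ends i j = ends i' j' -> i = i' /\ j = j'.
Proof.
move=> e; have := inl_ends i i' j'; have := inr_ends j i' j'.
by rewrite -e inl_ends inr_ends !eqxx => /esym/eqP -> /esym/eqP ->.
Qed.

Lemma kedgeP (e : edge K) : exists i j, e = kedge i j.
Proof.
have /imsetP [[[i|j] [i'|j']]] := valP e; rewrite inE //= => _ ee.
- by exists i, j'; apply: val_inj.
- by exists i', j; apply: val_inj; apply: etrans ee _; rewrite /= /ends setUC.
Qed.

(** [ca] and [cb] hold the colors at the left and right ends; their injectivity is properness at
    left and right vertices. *)
Lemma edge_colorable_of_ends (sigma : edge K -> int) (n : nat)
    (ca cb : 'I_r -> 'I_t -> int) :
  is_signature sigma ->
  (forall i j, (ca i j \in colors n) && (cb i j \in colors n)) ->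
  (forall i j, ca i j = - sigma (kedge i j) * cb i j) ->
  (forall i, injective (ca i)) -> (forall j, injective (cb^~ j)) ->
  edge_colorable sigma n.
Proof.
move=> sg hcol hs ha hb.
(* The default 0 is never reached, by [kedgeP], and the picked pair is unique, by [ends_inj]. *)
pose f (x : incidence K) : int :=
  if [pick p | iedge x == kedge p.1 p.2] is Some p then
    if ivertex x is inl _ then ca p.1 p.2 else cb p.1 p.2
  else 0.
have fE x : exists i j, [/\ iedge x = kedge i j &
    (ivertex x = inl i /\ f x = ca i j) \/ (ivertex x = inr j /\ f x = cb i j)].
  have [i [j e]] := kedgeP (iedge x); exists i, j; split=> //; rewrite /f.
  case: pickP => [p /eqP|/(_ (i, j))]; last by rewrite e eqxx.
  rewrite e => /(congr1 val)/ends_inj [<- <-].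
  have : ivertex x \in val (iedge x) := valP x.
  rewrite e /=; case: (ivertex x) => [a|b]; rewrite ?inl_ends ?inr_ends.
    by move/eqP->; left.
  by move/eqP->; right.
exists f; split.
- move=> x; have [i [j [_ h]]] := fE x; have /andP[ca_col cb_col] := hcol i j.
  by case: h => [[_ ->]|[_ ->]].
- move=> x y; have [i [j [-> hx]]] := fE x; have [i' [j' [-> hy]]] := fE y.
  move=> /(congr1 val)/ends_inj [? ?]; subst i' j'.
  case: hx => [[-> ->]|[-> ->]]; case: hy => [[-> ->]|[-> ->]] // _.
  (* A sign is its own inverse, so the relation also holds from right to left. *)
  by rewrite hs; case: (sg (kedge i j)) => ->; lia.
- move=> x y; have [i [j [-> hx]]] := fE x; have [i' [j' [-> hy]]] := fE y.
  case: hx => [[-> ->]|[-> ->]]; case: hy => [[-> ->]|[-> ->]] // [<-] ne e.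
    by apply: ne; rewrite (ha _ _ _ e).
  by apply: ne; rewrite (hb _ _ _ e).
Qed.

Lemma kedge_inl_subproof i j : inl i \in val (kedge i j).
Proof. by rewrite inl_ends. Qed.

Lemma kedge_inr_subproof i j : inr j \in val (kedge i j).
Proof. by rewrite inr_ends. Qed.

(** The edges at one vertex have distinct colors; one vertex from each side gives the bounds r and
    t. *)
Lemma edge_colorable_ge_size (sigma : edge K -> int) (n : nat) :
  (0 < r)%N -> (0 < t)%N -> edge_colorable sigma n -> (maxn r t <= n)%N.
Proof.
move=> r0 t0 [f [fcol _ fneq]]; rewrite geq_max; apply/andP; split.
- pose x i : incidence K := exist _ (inr (Ordinal t0), kedge i (Ordinal t0))
    (kedge_inr_subproof _ _).
  have finj : injective (f \o x).
    move=> i i' e; apply/eqP/negP => /negP ne; apply: (fneq (x i) (x i')) => //.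
    by move=> /(congr1 val)/ends_inj [] /eqP; rewrite (negPf ne).
  rewrite -[leqLHS]card_ord cardE -(size_map (f \o x)).
  apply: size_uniq_colors; first by rewrite map_inj_uniq ?enum_uniq.
  by move=> _ /mapP [i _ ->]; apply: fcol.
- pose x j : incidence K := exist _ (inl (Ordinal r0), kedge (Ordinal r0) j)
    (kedge_inl_subproof _ _).
  have finj : injective (f \o x).
    move=> i i' e; apply/eqP/negP => /negP ne; apply: (fneq (x i) (x i')) => //.
    by move=> /(congr1 val)/ends_inj [] _ /eqP; rewrite (negPf ne).
  rewrite -[leqLHS]card_ord cardE -(size_map (f \o x)).
  apply: size_uniq_colors; first by rewrite map_inj_uniq ?enum_uniq.
  by move=> _ /mapP [i _ ->]; apply: fcol.
Qed.

Lemma max_degree_complete_bipartite :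
  (0 < r)%N -> (0 < t)%N -> max_degree K = maxn r t.
Proof.
move=> r0 t0.
have degl i : #|[set y : K | adj (inl i : K) y]| = t.
  rewrite -[RHS]card_ord -(card_imset 'I_t (@inr_inj 'I_r 'I_t)).
  apply: eq_card => -[a|b]; rewrite inE /=.
    by symmetry; apply/negP => /imsetP [].
  by rewrite imset_f.
have degr j : #|[set y : K | adj (inr j : K) y]| = r.
  rewrite -[RHS]card_ord -(card_imset 'I_r (@inl_inj 'I_r 'I_t)).
  apply: eq_card => -[a|b]; rewrite inE /=.
    by rewrite imset_f.
  by symmetry; apply/negP => /imsetP [].
apply/eqP; rewrite eqn_leq; apply/andP; split.
  by apply/bigmax_leqP => -[i|j] _; rewrite ?degl ?degr ?leq_maxl ?leq_maxr.
have le_deg (x : K) := @leq_bigmax K (fun x => #|[set y | adj x y]|) x.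
have := le_deg (inr (Ordinal t0)); have := le_deg (inl (Ordinal r0)).
by rewrite degl degr geq_max => -> ->.
Qed.

End CompleteBipartiteColoring.

Local Open Scope nat_scope.

Theorem theorem7 (r t : nat) (hr : 0 < r) (ht : 0 < t) (hrt : r <> t) :
  class1pm (complete_bipartite r t).
Proof.
move=> sigma sg; rewrite max_degree_complete_bipartite //; split.
- by rewrite leq_max hr.
- case: (ltngtP r t) => // [lt_rt|lt_tr].
    have [ca [cb [hcol hs ha hb]]] :=
      ordinal_bicoloring lt_rt (fun i j => sg (kedge i j)).
    exact: (edge_colorable_of_ends sg hcol hs ha hb).
  (* The smaller side must come first, so the sides are exchanged and the result transposed. *)
  have [cb [ca [hcol hs hb ha]]] :=
    ordinal_bicoloring lt_tr (fun j i => sg (kedge i j)).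
  apply: (@edge_colorable_of_ends _ _ sigma r (fun i j => ca j i)
    (fun i j => cb j i)) => // [i j|i j].
    by rewrite andbC.
  by rewrite hs; case: (sg (kedge i j)) => ->; lia.
- by move=> m _; apply: edge_colorable_ge_size.
Qed.
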